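(* Let $(\mathcal{M},\varphi)$ be a non-commutative probability space, let $a\in\mathcal{M}$ be a standard semicircular random variable, free from a standard symmetric Bernoulli random variable $b\in\mathcal{M}$. Then $a$ and $i(ab-ba)$ have semicircle distributions with variances $1$ and $2$ respectively, they are not free, and yet $\sigma a+i(ab-ba)$ has semicircle distribution with variance $\sigma^2+2$ for every $\sigma\in\mathbb{R}$.
   Context: A non-commutative probability space is a unital $*$-algebra with a positive unital linear functional $\varphi$; the distribution of a self-adjoint element $x$ is its moment sequence $(\varphi(x^k))_{k\ge0}$. Semicircle distribution of variance $s^2$: density $\frac{1}{2\pi s^2}\sqrt{4s^2-t^2}$ on $[-2s,2s]$ (moments $\varphi(x^{2k})=s^{2k}\frac{1}{k+1}\binom{2k}{k}$, odd moments zero); standard means variance $1$. Standard symmetric Bernoulli: distribution $\frac12(\delta_{-1}+\delta_1)$. Both $a$ and $b$ are self-adjoint. Elements $x,y$ are free if $\varphi(u_1\cdots u_r)=0$ whenever $r\ge1$, $\varphi(u_j)=0$ for all $j$ and the $u_j$ come alternatingly from the unital algebras generated by $x$ and by $y$. *)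

(* Defs.v *)
From HB Require Import structures.
From mathcomp Require Import all_boot all_order all_algebra.
From mathcomp Require Import all_classical all_reals all_analysis.
From mathcomp Require Export complex.

Set Implicit Arguments.
Unset Strict Implicit.
Unset Printing Implicit Defensive.

Import Order.TTheory GRing.Theory Num.Theory.
Import numFieldNormedType.Exports.

Local Open Scope classical_set_scope.
Local Open Scope ring_scope.
Local Open Scope complex_scope.

(* On R[i], 0 <= z means that z is real and nonnegative, so ncp_ge0 is the
   usual positivity of a functional. *)
Record ncProbSpace (R : realType) := NCProbSpace {
  ncp_alg :> algType R[i];
  star : ncp_alg -> ncp_alg;
  starK : involutive star;
  starD : {morph star : x y / x + y};
  starZ : forall (c : R[i]) (x : ncp_alg), star (c *: x) = c^* *: star x;
  starM : forall x y : ncp_alg, star (x * y) = star y * star x;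
  state : {scalar ncp_alg};
  state1 : state 1 = 1;
  state_ge0 : forall x : ncp_alg, 0 <= state (star x * x)
}.

Section Notions.
Context {R : realType} {M : ncProbSpace R}.
Implicit Types x y : M.

Definition selfadjoint x : Prop := star x = x.

Definition gen_subalg x : set M :=
  smallest [set S : set M | GRing.subalg_closed (mem S)] [set x].

(* A word is a list of tagged letters: those tagged false come from the algebra
   generated by x, those tagged true from the one generated by y. *)
Definition nc_free x y : Prop :=
  forall w : seq (bool * M),
    w != [::] ->
    sorted (fun p q => p.1 != q.1) w ->
    (forall p, p \in w ->
       gen_subalg (if p.1 then y else x) p.2 /\ state M p.2 = 0) ->
    state M (\prod_(p <- w) p.2) = 0.

Definition semicircle_density (v t : R) : R :=
  (2 * pi * v)^-1 * Num.sqrt (4 * v - t ^+ 2).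

Definition semicircle_moment (v : R) (k : nat) : R :=
  \int[lebesgue_measure]_(t in `[- (2 * Num.sqrt v), 2 * Num.sqrt v])
    (t ^+ k * semicircle_density v t).

(* v is the variance (s ^+ 2), to be taken positive. *)
Definition semicircular (v : R) x : Prop :=
  selfadjoint x /\
  forall k : nat, state M (x ^+ k) = (semicircle_moment v k)%:C.

(* The k-th moment of the half sum of the Dirac masses at -1 and 1. *)
Definition symmetric_bernoulli x : Prop :=
  selfadjoint x /\
  forall k : nat, state M (x ^+ k) = (((-1) ^+ k + 1 ^+ k) / 2 : R)%:C.

Definition i_commutator x y : M := ('i : R[i]) *: (x * y - y * x).

End Notions.

(* Main.v *)
(* Let P_n be the monic orthogonal polynomials of the semicircle law of variance
   v: P_{n+2} = X P_{n+1} - v P_n.  The law is characterised by L(1) = 1 and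
   L(P_n) = 0 for n >= 1, so with x = s a + i (ab - ba) and v = s^2 + 2 one has
   to show phi (P_n(x)) = 0.  Modulo the relation b^2 = 1, which phi cannot
   detect, an element of the algebra generated by a and b is a combination of
   reduced words U_{n0}(a) b U_{n1}(a) b ..., on which a acts as a creation plus
   an annihilation operator, a = l + l^*, with l^* l = 1 and
   l^* b l = phi(b) = 0.  Put e_0 = 1 and e_{n+1} = (s l + i l b - i b l) e_n.
   Then x e_{n+1} = e_{n+2} + v e_n, because the annihilation part of x, applied
   to e_{n+1}, gives (s^2 + 2) e_n: the terms linear in b cancel.  Hence, for
   n >= 1, P_n(x) = e_n has no component on the empty word.  Non-freeness comes
   from phi (a c a c) = -2 for c = i (ab - ba). *)
From HB Require Import structures.
Require Import Defs.
From mathcomp Require Import all_boot all_order all_algebra.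
From mathcomp Require Import all_classical all_reals all_analysis.
From mathcomp Require Import ring lra.

Set Implicit Arguments.
Unset Strict Implicit.
Unset Printing Implicit Defensive.

Import Order.TTheory GRing.Theory Num.Theory.
Import numFieldNormedType.Exports.
Local Open Scope classical_set_scope.
Local Open Scope ring_scope.
Local Open Scope complex_scope.

(* cheb v x n is v^(n/2) U_n (x / (2 sqrt v)), with U_n the Chebyshev polynomial
   of the second kind; it is locked because its recursion unfolds too eagerly
   during rewriting. *)
HB.lock Definition cheb (K : comNzRingType) (A : algType K) (v : K) (x : A)
    (n : nat) : A :=
  (iter n (fun p => (p.2, x * p.2 - v *: p.1)) (1, x)).1.

Section Chebyshev.
Context {K : comNzRingType} {A : algType K}.

Lemma cheb0 (v : K) (x : A) : cheb v x 0 = 1.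
Proof. by rewrite cheb.unlock. Qed.

Lemma cheb1 (v : K) (x : A) : cheb v x 1 = x.
Proof. by rewrite cheb.unlock. Qed.

Lemma chebSS (v : K) (x : A) n :
  cheb v x n.+2 = x * cheb v x n.+1 - v *: cheb v x n.
Proof. by rewrite cheb.unlock. Qed.

End Chebyshev.

(** * Differential equation of the Chebyshev polynomials *)

Section ChebyshevPoly.
Variables (R : numDomainType) (v : R).

Variable P : nat -> {poly R}.
Hypothesis P0 : P 0 = 1.
Hypothesis P1 : P 1 = 'X.
Hypothesis PSS : forall n, P n.+2 = 'X * P n.+1 - v%:P * P n.

Lemma deriv_cheb n :
  ((4 * v)%:P - 'X^2) * (P n.+1)^`() =
  (2 * n.+2%:R * v)%:P * P n - n.+1%:R * ('X * P n.+1).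
Proof.
elim/ltn_ind: n => -[|[|n]] IH.
- rewrite P0 P1 derivX; ring.
- rewrite PSS P0 P1 !poly.derivE/=; ring.
have := IH n.+1 (ltnSn _); have := IH n (ltnW (ltnSn _)).
rewrite (PSS n.+1) derivB !derivM derivX derivC.
have := PSS n.
set p := P n; set q := P n.+1; set r := P n.+2.
set q' := deriv q; set r' := deriv r; set D := (4 * v)%:P - 'X^2 => er e1 e2.
have -> : D * (1 * r + 'X * r' - (0 * q + v%:P * q')) =
    D * r + 'X * (D * r') - v%:P * (D * q') by ring.
by rewrite e1 e2 er /D; ring.
Qed.

Lemma deriv_chebS n :
  'X * (P n.+1)^`() - (2 * v)%:P * (P n)^`() = n.+1%:R * P n.+1.
Proof.
elim: n => [|n IH].
  by rewrite P0 P1 derivX derivC; ring.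
have := deriv_cheb n; move: IH.
rewrite PSS derivB !derivM derivX derivC.
set p := P n; set q := P n.+1; set q' := deriv q.
set p' := deriv p => IH e.
(* Doubling turns [v p'] into [2 v p'], as in the induction hypothesis, and [2 v q'] into [4 v q'],
   as in [deriv_cheb]. *)
have two_neq0 : (2 : {poly R}) != 0 by rewrite -polyC_natr polyC_eq0 pnatr_eq0.
apply: (mulfI two_neq0).
have {}IH : (2 * v)%:P * p' = 'X * q' - n.+1%:R * q by rewrite -IH; ring.
transitivity ('X * (2 * q + 2 * 'X * q' - (2 * v)%:P * p') - (4 * v)%:P * q').
  by ring.
rewrite IH.
transitivity (n.+3%:R * 'X * q - ((4 * v)%:P - 'X^2) * q'); first by ring.
by rewrite e; ring.
Qed.

(** Differentiating [deriv_cheb] leaves a term in the derivative of [P n], which [deriv_chebS]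
    eliminates. With [q] the derivative of [P n.+1], the left side has the shape
    [(4 v - X^2) q' - 3 X q], which integrates to zero against the semicircle density. *)
Lemma cheb_ode n :
  ((4 * v)%:P - 'X^2) * (P n.+1)^`()^`() - 3%:P * ('X * (P n.+1)^`()) =
  (- (n.+1 * n.+3)%:R)%:P * P n.+1.
Proof.
have := congr1 (@deriv R) (deriv_cheb n); have := deriv_chebS n.
rewrite -!polyC_natr !(derivM, derivB, derivC, derivXn, derivX).
set p := P n; set q := P n.+1; set q' := deriv q; set p' := deriv p.
set q'' := deriv q' => e1.
have {}e1 : (2 * v)%:P * p' = 'X * q' - n.+1%:R * q.
  by rewrite -polyC_natr -e1; ring.
set lhs := (X in X = _ -> _) => e2.
have -> : ((4 * v)%:P - 'X^2) * q'' - 3%:P * ('X * q') = lhs - 'X * q'.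
  by rewrite /lhs; ring.
rewrite e2.
transitivity (n.+2%:R * ((2 * v)%:P * p') -
  n.+1%:R * (q + 'X * q') - 'X * q'); first by ring.
by rewrite e1; ring.
Qed.

End ChebyshevPoly.

(** * Integration against the semicircle density *)

Section SemicircleIntegral.
Variables (R : realType) (v : R).
Hypothesis v_gt0 : 0 < v.

Let s := 2 * Num.sqrt v.
Let D : {poly R} := (4 * v)%:P - 'X^2.

Let s_gt0 : 0 < s. Proof. by rewrite mulr_gt0// sqrtr_gt0. Qed.

Let sqr_s : s ^+ 2 = 4 * v.
Proof. by rewrite exprMn sqr_sqrtr ?ltW// -natrX. Qed.

Definition semicircle_int (p : {poly R}) : R :=
  \int[lebesgue_measure]_(t in `[- s, s]) (p.[t] * semicircle_density v t).

Lemma continuous_semicircle_density : continuous (semicircle_density v).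
Proof.
move=> t; apply: cvgM; first exact: cvg_cst.
apply: continuous_comp; last exact: sqrt_continuous.
by apply: cvgB; [exact: cvg_cst|exact: exprn_continuous].
Qed.

Let continuous_integrand (p : {poly R}) :
  {within `[- s, s], continuous (fun t => p.[t] * semicircle_density v t)}.
Proof.
apply: continuous_subspaceT => t; apply: cvgM; first exact: continuous_horner.
exact: continuous_semicircle_density.
Qed.

Let integrable_integrand (p : {poly R}) :
  (@lebesgue_measure R).-integrable `[- s, s]
    (EFin \o (fun t => p.[t] * semicircle_density v t)).
Proof.
by apply: continuous_compact_integrable; first exact: segment_compact.
Qed.

Lemma semicircle_intD p q :
  semicircle_int (p + q) = semicircle_int p + semicircle_int q.
Proof.
rewrite -RintegralD//; do ?exact: integrable_integrand.
by apply: eq_Rintegral => t _; rewrite hornerD mulrDl.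
Qed.

Lemma semicircle_intZ c p : semicircle_int (c *: p) = c * semicircle_int p.
Proof.
rewrite -RintegralZl//; do ?exact: integrable_integrand.
by apply: eq_Rintegral => t _; rewrite /= hornerZ -mulrA.
Qed.

Lemma semicircle_intB p q :
  semicircle_int (p - q) = semicircle_int p - semicircle_int q.
Proof. by rewrite -scaleN1r semicircle_intD semicircle_intZ mulN1r. Qed.

(* Up to a constant, one integrates the derivative of q(t) (4v - t^2)^(3/2). *)
Lemma semicircle_int_Pearson (q : {poly R}) :
  semicircle_int (D * q^`() - 3%:P * ('X * q)) = 0.
Proof.
pose c := (2 * pi * v)^-1.
pose F t := c * (q.[t] * (D.[t] * Num.sqrt (D.[t]))).
have DE t : D.[t] = 4 * v - t ^+ 2 by rewrite /D !hornerE.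
have Ds0 t : t ^+ 2 = s ^+ 2 -> F t = 0.
  by rewrite /F DE -sqr_s => ->; rewrite subrr mul0r mulr0 mulr0.
have cF : continuous F.
  move=> t; apply: cvgM; first exact: cvg_cst.
  apply: cvgM; first exact: continuous_horner.
  apply: cvgM; first exact: continuous_horner.
  apply: continuous_comp; first exact: continuous_horner.
  exact: sqrt_continuous.
(* Differentiating the square root needs [D.[t] > 0], hence the open interval; continuity of [F]
   handles the endpoints. *)
have dF t : t \in `]- s, s[ -> is_derive t 1 F
   ((D * q^`() - 3%:P * ('X * q)).[t] * semicircle_density v t).
  rewrite in_itv/= => /andP[lt tl].
  have Dt : 0 < D.[t].
    by rewrite DE -sqr_s subr_sqr mulr_gt0 ?subr_gt0// -[s]opprK addrC subr_gt0.
  have sD := is_derive1_sqrt Dt.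
  have dD : is_derive t 1 (horner D) (- 2 * t).
    rewrite [X in is_derive _ _ _ X](_ : _ = D^`().[t]).
      exact: is_derive_poly.
    by rewrite /D derivB derivC derivXn !hornerE; ring.
  have dq : is_derive t 1 (horner q) q^`().[t] by exact: is_derive_poly.
  have dsD := @is_derive1_comp R (@Num.sqrt R) (horner D) t _ _ sD dD.
  have dDs := @is_deriveM R R^o (horner D) _ t 1 _ _ dD dsD.
  have dqs := @is_deriveM R R^o (horner q) _ t 1 _ _ dq dDs.
  have dFt : is_derive t 1 F _ := @is_deriveZ R R^o R^o _ c t 1 _ dqs.
  apply: (is_derive_eq dFt).
  rewrite /semicircle_density -/c !hornerE /= /GRing.scale/= !fctE/= !DE.
  set r := Num.sqrt _.
  have r0 : r != 0 by rewrite gt_eqF// sqrtr_gt0 -DE.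
  have <- : r ^+ 2 = 4 * v - t ^+ 2 by rewrite sqr_sqrtr// -DE ltW.
  by field.
have itv_lt : - s < s by rewrite gtrN.
rewrite /semicircle_int /Rintegral (continuous_FTC2 (F := F)) //=.
- by rewrite !Ds0 ?sqrrN//= subrr.
- split; [by move=> t /dF []| |].
    exact: cvg_at_right_filter (cF _).
  exact: cvg_at_left_filter (cF _).
- by move=> t /dF dFt; rewrite derive1E; apply: derive_val.
Qed.

(** By [cheb_ode], the Pearson identity for the derivative of [P n.+1] is this integral times
    [-(n+1)(n+3)], which is nonzero. *)
Lemma semicircle_int_cheb n : semicircle_int (cheb v 'X n.+1) = 0.
Proof.
have := semicircle_int_Pearson (cheb v ('X : {poly R}) n.+1)^`().
rewrite (@cheb_ode _ v (cheb v 'X)); last 3 first.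
- exact: cheb0.
- exact: cheb1.
- by move=> k; rewrite chebSS mul_polyC.
rewrite mul_polyC semicircle_intZ => /eqP; rewrite mulf_eq0 oppr_eq0 pnatr_eq0.
by move=> /eqP.
Qed.

Lemma semicircle_int_Xn k : semicircle_int ('X ^+ k) = semicircle_moment v k.
Proof. by apply: eq_Rintegral => t _; rewrite hornerXn. Qed.

(* The total mass of the density is never computed: scaling reduces it to v = 1,
   where it is phi (a ^+ 0). *)
Lemma semicircle_moment0_scaling :
  semicircle_moment v 0 = semicircle_moment 1 0.
Proof.
set r := Num.sqrt v; have r_gt0 : 0 < r by rewrite sqrtr_gt0.
have rv : r ^+ 2 = v by rewrite sqr_sqrtr ?ltW.
have df (t : R) : is_derive t 1 (fun u : R => r * u) r.
  have dft : is_derive t 1 (fun u : R => r * u) _ :=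
    @is_deriveZ R R^o R^o id r t 1 _ (is_derive_id _ _).
  by apply: (is_derive_eq dft); rewrite /GRing.scale/= mulr1.
have dE : (fun u : R => r * u)^`()%classic = cst r.
  by apply/funext => t; rewrite derive1E; apply: derive_val.
have cf : continuous (fun u : R => r * u).
  by move=> t; apply: cvgM; [exact: cvg_cst|exact: cvg_id].
have sE : s = r * 2 by rewrite mulrC.
rewrite /semicircle_moment /Rintegral -/s sqrtr1 mulr1 sE -mulrN.
rewrite (@integration_by_substitution_increasing _ (fun u => r * u)) //.
- congr fine; apply: eq_integral => t _; congr EFin.
  rewrite !fctE dE /= !expr0 !mul1r /semicircle_density.
  rewrite -rv !mulr1.
  have -> : 4 * r ^+ 2 - (r * t) ^+ 2 = r ^+ 2 * (4 - t ^+ 2) by ring.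
  rewrite sqrtrM ?sqr_ge0// sqrtr_sqr gtr0_norm//.
  have := gt_eqF (pi_gt0 R); move: pi => p p0.
  by field; rewrite p0 gt_eqF.
- lra.
- by move=> x y _ _ xy; rewrite ltr_pM2l.
- by move=> t _; rewrite dE; exact: cvg_cst.
- by rewrite dE; exact: is_cvg_cst.
- by rewrite dE; exact: is_cvg_cst.
- split; first by move=> t _; case: (df t).
    exact: cvg_at_right_filter (cf _).
  exact: cvg_at_left_filter (cf _).
- apply: continuous_subspaceT => t; apply: cvgM; first exact: exprn_continuous.
  exact: continuous_semicircle_density.
Qed.

End SemicircleIntegral.

(** * Moments versus expectations of Chebyshev polynomials *)

Section Moments.
Variables (R : realType) (M : ncProbSpace R) (v : R) (x : M).
Hypothesis v_gt0 : 0 < v.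

Let mulr_chebS (K : comNzRingType) (A : algType K) (u : K) (y : A) n :
  y * cheb u y n.+1 = cheb u y n.+2 + u *: cheb u y n.
Proof. by rewrite chebSS subrK. Qed.

Let P (n : nat) : {poly R} := cheb v 'X n.
Let Q (n : nat) : M := cheb v%:C x n.

(** Mixed quantities linking the two descriptions of the law: [k = 0] gives the Chebyshev
    expectations, [n = 0] the moments. The recurrence of [P] trades a power of X for neighbouring
    indices, so induction on [k] goes one way and induction on [n] the other. *)
Let agree k n : Prop :=
  state M (x ^+ k * Q n) = (semicircle_int v ('X^k * P n))%:C.

Let agree_mulX k n : agree k n -> agree k n.+2 -> agree k.+1 n.+1.
Proof.
rewrite /agree !exprSr -!mulrA /Q /P !mulr_chebS !mulrDr -!scalerAr.
rewrite linearD linearZ semicircle_intD// semicircle_intZ//= => -> ->.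
by rewrite rmorphD rmorphM.
Qed.

Lemma cheb_state_moments :
  semicircle_moment v 0 = 1 -> (forall n, state M (Q n.+1) = 0) ->
  forall k, state M (x ^+ k) = (semicircle_moment v k)%:C.
Proof.
move=> m0 Qn k; suff: forall n, agree k n.
  by move=> /(_ 0); rewrite /agree /Q /P !cheb0 !mulr1 semicircle_int_Xn.
elim: k => [|k IH] [|n].
- by rewrite /agree /P /Q !cheb0 !mulr1 semicircle_int_Xn m0 expr0 state1.
- by rewrite /agree !expr0 !mul1r Qn semicircle_int_cheb.
- by have := IH 1; rewrite /agree /Q /P !cheb0 !cheb1 !mulr1 !exprSr.
- exact: agree_mulX.
Qed.

Lemma moments_cheb_state :
  (forall k, state M (x ^+ k) = (semicircle_moment v k)%:C) ->
  forall n, state M (Q n.+1) = 0.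
Proof.
move=> mom n; suff: forall k, agree k n.+1.
  by move=> /(_ 0); rewrite /agree !expr0 !mul1r semicircle_int_cheb.
have agree0 k : agree k 0.
  by rewrite /agree /Q /P !cheb0 !mulr1 semicircle_int_Xn.
have agree1 k : agree k 1.
  by have := agree0 k.+1; rewrite /agree /Q /P !cheb0 !cheb1 !mulr1 !exprSr.
elim/ltn_ind: n => -[|n] IH k //.
have := IH n (ltnSn _) k.+1.
have : agree k n by case: n IH => // n IH; apply: IH.
rewrite /agree /Q /P !chebSS !mulrBr !mulrA -!exprSr -!scalerAr.
rewrite linearB linearZ semicircle_intB// semicircle_intZ//= => -> ->.
by rewrite rmorphB rmorphM.
Qed.

End Moments.

(** * The algebra generated by one element, as polynomials in it *)

Section GeneratedSubalgebra.
Variables (R : realType) (M : ncProbSpace R).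
Implicit Type x y : M.

Lemma gen_subalgP x y : gen_subalg x y <-> exists p, y = horner_alg x p.
Proof.
split=> [gen|[p ->]].
  apply: (gen [set z | exists p, z = horner_alg x p]); split;
    last by move=> _ ->; exists 'X; rewrite horner_algX.
  split; rewrite ?inE.
  - by exists 1; rewrite rmorph1.
  - move=> c _ _ /[!inE] -[p ->] [q ->]; exists (c *: p + q).
    by rewrite linearD linearZ /= mulr_algl.
  - move=> _ _ /[!inE] -[p ->] [q ->]; exists (p * q).
    by rewrite rmorphM.
move=> S [[S1 SP SM] Sx].
have {}Sx : x \in mem S by rewrite inE; apply: Sx.
suff: horner_alg x p \in mem S by rewrite inE.
(* Closure only provides [c *: u + v], so zero is obtained as [-1 *: 1 + 1]. *)
have S0 : 0 \in mem S.
  by have := SP (-1) _ _ S1 S1; rewrite scaleN1r addNr.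
have SC c : c%:A \in mem S by have := SP c _ _ S1 S0; rewrite addr0.
elim/poly_ind: p => [|p c IH]; first by rewrite rmorph0.
rewrite rmorphD rmorphM /= horner_algX horner_algC.
by rewrite -[_ * x]scale1r; apply: SP; rewrite ?SC// SM.
Qed.

End GeneratedSubalgebra.

(** Additive bookkeeping for the recurrence in [cheb_fock]; the doubled [E] is the constant 2 of the
    variance [s ^+ 2 + 2]. *)
Lemma zmod_regroup (V : zmodType) (A1 A2 A3 A4 S E H B D : V) :
  A1 - (S + H) + (A4 - E) - (A3 - (B - D)) =
  A1 + A2 - A3 - (S + (E + E)) - (A2 - A4 - (B - H) + (D - E)).
Proof.
apply/eqP; rewrite eq_sym subr_eq; apply/eqP.
rewrite !opprD !opprK !addrA.
rewrite [RHS](ACl (1*9*6*2*5*14*(3*12)*(4*10)*(7*11)*(8*13))%AC)/=.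
by rewrite !addNr !subrr !addr0.
Qed.

(** * Creation and annihilation on reduced words *)

Section ReducedWords.
Variables (K : comNzRingType) (A : algType K) (phi : {scalar A}) (a b : A).
Hypothesis phi1 : phi 1 = 1.
Local Notation letter := (bool * {poly K})%type.
Implicit Types (l : letter) (w : seq letter) (p q : {poly K}) (z e f : A).

(* The letter (t, p) stands for p(b) if t holds and for p(a) otherwise. *)
Definition letter_val l : A := horner_alg (if l.1 then b else a) l.2.

Definition word_val w : A := \prod_(l <- w) letter_val l.

Lemma word_val_cons l w : word_val (l :: w) = letter_val l * word_val w.
Proof. by rewrite /word_val big_cons. Qed.

Lemma word_val_nil : word_val [::] = 1.
Proof. by rewrite /word_val big_nil. Qed.

(** The empty word counts as starting with either kind, so that any letter may be put in front of
    it. *)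
Definition starts (t : bool) w := if w is l :: _ then l.1 == t else true.

Fixpoint reduced w : Prop :=
  if w is l :: w' then
    [/\ phi (letter_val l) = 0, starts (~~ l.1) w' & reduced w']
  else True.

Hypothesis phi_word : forall w, w != [::] -> reduced w -> phi (word_val w) = 0.

(* Letters vanishing when b^2 = 1. *)
Definition killing l := l.1 /\ exists q, l.2 = q * ('X^2 - 1).

Fixpoint has_killing w : Prop :=
  if w is l :: w' then killing l \/ has_killing w' else False.

(* The elements of the ideal generated by b^2 - 1, on which phi vanishes; they
   replace the relation b^2 = 1, which need not hold in A. *)
Inductive null : A -> Prop :=
| null0 : null 0
| nullD c w z : reduced w -> has_killing w -> null z ->
    null (c *: word_val w + z).

Lemma nullZD c z z' : null z -> null z' -> null (c *: z + z').
Proof.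
move=> + nz'; elim=> [|k w u rw kw _ IH]; first by rewrite scaler0 add0r.
by rewrite scalerDr scalerA -addrA; apply: nullD.
Qed.

Lemma null_add z z' : null z -> null z' -> null (z + z').
Proof. by move=> nz nz'; rewrite -[z]scale1r; apply: nullZD. Qed.

Lemma null_scale c z : null z -> null (c *: z).
Proof.
by move=> nz; rewrite -[_ *: z]addr0; apply: nullZD => //; apply: null0.
Qed.

Lemma null_sub z z' : null z -> null z' -> null (z - z').
Proof. by move=> nz nz'; rewrite addrC -scaleN1r; apply: nullZD. Qed.

Lemma null_word w : reduced w -> has_killing w -> null (word_val w).
Proof.
move=> rw kw; rewrite -[word_val w]scale1r -[_ *: _]addr0.
by apply: nullD => //; apply: null0.
Qed.

Lemma phi_null z : null z -> phi z = 0.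
Proof.
elim=> [|c w u rw kw _ IH]; first exact: linear0.
rewrite linearD linearZ IH /= phi_word ?mulr0 ?addr0//.
by case: w kw {rw}.
Qed.

Definition center t p := p - (phi (letter_val (t, p)))%:P.

Lemma letter_val_center t p :
  letter_val (t, p) = letter_val (t, center t p) + (phi (letter_val (t, p)))%:A.
Proof. by rewrite /letter_val/= rmorphB /= horner_algC subrK. Qed.

Lemma phi_center t p : phi (letter_val (t, center t p)) = 0.
Proof.
have := congr1 (phi) (letter_val_center t p).
rewrite linearD linearZ /= phi1 mulr1 => /eqP.
by rewrite -subr_eq subrr eq_sym => /eqP.
Qed.

Hypothesis phi_b2 : forall q, phi (horner_alg b (q * ('X^2 - 1))) = 0.

Lemma phi_killing l : killing l -> phi (letter_val l) = 0.
Proof. by case: l => -[] p [//= _ [q ->]]; apply: phi_b2. Qed.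

(** A new letter of the other kind is recentred, giving a longer word plus a multiple of the old
    one. A letter of the same kind merges with the first one: if that one is killing, so is the
    product, which is then already centred; otherwise the product is recentred and the killing
    letter survives in the tail. *)
Lemma null_mull t p z : null z -> null (letter_val (t, p) * z).
Proof.
elim=> [|c w u rw kw _ IH]; first by rewrite mulr0; apply: null0.
rewrite mulrDr -scalerAr; apply: nullZD => // {c u IH}.
case: w rw kw => // -[t' p'] w rw kw.
have [tt'|tt'] := eqVneq t' t; last first.
  rewrite letter_val_center mulrDl mulr_algl; apply: null_add.
    rewrite -word_val_cons; apply: null_word; last by right.
    by split=> //=; [exact: phi_center|case: (t) (t') tt' => -[]].
  exact/null_scale/null_word.
case: rw => /= p'0 sw rw.
rewrite word_val_cons mulrA.
have -> : letter_val (t, p) * letter_val (t', p') = letter_val (t, p * p').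
  by rewrite /letter_val /= tt' -rmorphM.
case: kw => [kp'|kw].
  have kpp' : killing (t, p * p').
    case: kp' => /= t'1 [q ->].
    by split; [rewrite /= -tt'|exists (p * q); rewrite mulrA].
  rewrite -word_val_cons; apply: null_word; last by left.
  by split=> //=; [exact: phi_killing|rewrite -tt'].
rewrite letter_val_center mulrDl mulr_algl; apply: null_add.
  rewrite -word_val_cons; apply: null_word; last by right.
  by split=> //=; [exact: phi_center|rewrite -tt'].
exact/null_scale/null_word.
Qed.

Lemma null_mula z : null z -> null (a * z).
Proof. by move=> /(null_mull false 'X); rewrite /letter_val horner_algX. Qed.

Lemma null_mulb z : null z -> null (b * z).
Proof. by move=> /(null_mull true 'X); rewrite /letter_val horner_algX. Qed.

Lemma null_sqr_b1 : null (b * b - 1).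
Proof.
have -> : b * b - 1 = word_val [:: (true, 'X^2 - 1)].
  rewrite word_val_cons word_val_nil mulr1 /letter_val.
  by rewrite rmorphB rmorphXn rmorph1 /= horner_algX.
have k : killing (true, 'X^2 - 1) by split=> //; exists 1; rewrite mul1r.
by apply: null_word; [split=> //; exact: phi_killing|left].
Qed.

Hypothesis cheb_a : forall n, phi (cheb 1 a n.+1) = 0.

Local Notation U := (cheb (1 : K) a).

Lemma cheb_horner (v : K) (x : A) n :
  cheb v x n = horner_alg x (cheb v ('X : {poly K}) n).
Proof.
elim/ltn_ind: n => -[|[|n]] IH.
- by rewrite !cheb0 rmorph1.
- by rewrite !cheb1 horner_algX.
- rewrite !chebSS rmorphB rmorphM -mul_polyC rmorphM /= horner_algX horner_algC.
  by rewrite mulr_algl -!IH// ltnW.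
Qed.

(* creates e f means f = l e for the creation operator l that sends U_n(a) w to
   U_{n+1}(a) w whenever w does not start with a letter in a. *)
Inductive creates : A -> A -> Prop :=
| creates0 : creates 0 0
| createsD c n w e f : reduced w -> starts true w -> creates e f ->
    creates (c *: (U n * word_val w) + e) (c *: (U n.+1 * word_val w) + f).

Lemma createsZD c e f e' f' : creates e f -> creates e' f' ->
  creates (c *: e + e') (c *: f + f').
Proof.
move=> + cef'; elim=> [|k n w u u' rw sw _ IH]; first by rewrite scaler0 !add0r.
by rewrite !scalerDr !scalerA -!addrA; apply: createsD.
Qed.

Let createsZ c e f : creates e f -> creates (c *: e) (c *: f).
Proof.
move=> ef; rewrite -[c *: e]addr0 -[c *: f]addr0; apply: createsZD => //.
exact: creates0.
Qed.

Let creates_add e f e' f' : creates e f -> creates e' f' ->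
  creates (e + e') (f + f').
Proof. by move=> ef ef'; rewrite -[e]scale1r -[f]scale1r; apply: createsZD. Qed.

Lemma creates_word n w : reduced w -> starts true w ->
  creates (U n * word_val w) (U n.+1 * word_val w).
Proof.
by move=> rw sw; have := createsD 1 n rw sw creates0; rewrite !scale1r !addr0.
Qed.

Lemma creates1 : creates 1 a.
Proof.
have := @creates_word 0 [::] I isT.
by rewrite word_val_nil !mulr1 cheb0 cheb1.
Qed.

(** The semicircular law of [a] enters through [cheb_a], which makes [U n.+1] a centred letter. *)
Let cheb_word n w : reduced w -> starts true w ->
  let w' := (false, cheb 1 'X n.+1) :: w in
  reduced w' /\ word_val w' = U n.+1 * word_val w.
Proof.
move=> rw sw w'.
have lE : letter_val (false, cheb 1 'X n.+1) = U n.+1.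
  by rewrite /letter_val cheb_horner.
by split; [split=> //; rewrite lE cheb_a|rewrite word_val_cons lE].
Qed.

Lemma phi_creates e f : creates e f -> phi f = 0.
Proof.
elim=> [|c n w u u' rw sw _ IH]; first exact: linear0.
have [rw' <-] := cheb_word n rw sw.
by rewrite linearD linearZ IH /= phi_word ?mulr0 ?addr0.
Qed.

(* Annihilation undoes creation: a f = l f + e. *)
Lemma creates_step e f : creates e f -> creates f (a * f - e).
Proof.
elim=> [|c n w u u' rw sw _ IH]; first by rewrite mulr0 subr0; exact: creates0.
rewrite mulrDr opprD addrACA -scalerAr -scalerBr mulrA -mulrBl.
have -> : a * U n.+1 - U n = U n.+2 by rewrite chebSS scale1r.
exact: createsD.
Qed.

Hypothesis phi_b : phi b = 0.

Let b_cheb_word n w : reduced w -> starts true w ->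
  let w' := [:: (true, 'X), (false, cheb 1 'X n.+1) & w] in
  reduced w' /\ word_val w' = b * (U n.+1 * word_val w).
Proof.
move=> rw sw w'; have [rw' wE] := cheb_word n rw sw.
have lE : letter_val (true, 'X) = b by rewrite /letter_val horner_algX.
by split; [split=> //; rewrite lE|rewrite word_val_cons lE wE].
Qed.

Lemma creates_b : creates b (a * b).
Proof.
have lE : letter_val (true, 'X) = b by rewrite /letter_val horner_algX.
have rb : reduced [:: (true, 'X)] by split; rewrite // lE.
have := @creates_word 0 _ rb isT.
by rewrite word_val_cons word_val_nil !mulr1 lE cheb0 cheb1 mul1r.
Qed.

(* There is no annihilation term: it would be phi (b) *: e. *)
Lemma creates_mulb e f : creates e f -> creates (b * f) (a * (b * f)).
Proof.
elim=> [|c n w u u' rw sw _ IH]; first by rewrite !mulr0; exact: creates0.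
have [rw' <-] := cheb_word n rw sw; have [rw'' wE] := b_cheb_word n rw sw.
rewrite !mulrDr -!scalerAr; apply: creates_add => //; apply: createsZ.
have := creates_word 0 rw'' isT.
by rewrite wE cheb0 cheb1 mul1r; have [_ <-] := cheb_word n rw sw.
Qed.

Lemma phi_mulb_creates e f : creates e f -> phi (b * f) = 0.
Proof.
elim=> [|c n w u u' rw sw _ IH]; first by rewrite mulr0 linear0.
have [rw' wE] := b_cheb_word n rw sw.
rewrite mulrDr -scalerAr -wE.
by rewrite linearD linearZ IH /= phi_word ?mulr0 ?addr0.
Qed.

(** The words of [f] start with a letter in [a], so the killing letter [X^2 - 1] in [b] can be put
    in front of them and they stay reduced. *)
Lemma null_creates e f : creates e f -> null (b * (b * f) - f).
Proof.
elim=> [|c n w u u' rw sw _ IH]; first by rewrite !mulr0 subr0; exact: null0.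
rewrite !mulrDr opprD addrACA -!scalerAr -scalerBr; apply: nullZD => //.
have [rw' wE] := cheb_word n rw sw.
rewrite mulrA -[X in _ - X]mul1r -mulrBl -wE.
have -> : b * b - 1 = letter_val (true, 'X^2 - 1).
  by rewrite /letter_val rmorphB rmorphXn rmorph1 /= horner_algX.
have k : killing (true, 'X^2 - 1) by split=> //; exists 1; rewrite mul1r.
rewrite -word_val_cons; apply: null_word; last by left.
by split=> //; exact: phi_killing.
Qed.

(** * Three-term recurrence for the perturbed element *)

Section Recurrence.
Variables s i : K.
Hypothesis sqr_i : i * i = -1.
Let x : A := s *: a + i *: (a * b - b * a).
Let v : K := s ^+ 2 + 2.

Let Xmul z : x * z = s *: (a * z) + i *: (a * (b * z)) - i *: (b * (a * z)).
Proof.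
by rewrite /x mulrDl -!scalerAl mulrBl scalerBr !mulrA addrA.
Qed.

(* h0 plays the role of b * e0, to which it is only equal modulo null. *)
Lemma cheb_fock n : exists e0 h0 f0 g0,
  let e := s *: f0 + i *: g0 - i *: (b * f0) in
  let h := s *: (b * f0) + i *: (b * g0) - i *: f0 in
  [/\ creates e0 f0, creates h0 g0,
      null (b * e0 - h0), null (b * h0 - e0) &
      null (cheb v x n - e0) /\ null (cheb v x n.+1 - e)].
Proof.
elim: n => [|n [e0 [h0 [f0 [g0 [cf0 cg0 be0 bh0 [ce0 ce]]]]]]].
  exists 1, b, a, (a * b); split; rewrite ?mulr1 ?subrr; do ?exact: null0.
  - exact: creates1.
  - exact: creates_b.
  - exact: null_sqr_b1.
  - rewrite cheb0 cheb1 subrr; split; first exact: null0.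
    by rewrite -[x]mulr1 Xmul !mulr1 subrr; exact: null0.
pose e := s *: f0 + i *: g0 - i *: (b * f0); rewrite -/e in ce.
pose h := s *: (b * f0) + i *: (b * g0) - i *: f0.
(* [f] and [g] are the creations of [e] and [h]: from [a * e] and [a * h] one removes the
   annihilation parts [s e0 + i h0] and [- i e0], to which words starting with [b] contribute
   nothing. *)
pose f := a * e - (s *: e0 + i *: h0).
pose g := a * h + i *: e0.
have cf : creates e f.
  have -> : f = s *: (a * f0 - e0) + i *: (a * g0 - h0) - i *: (a * (b * f0)).
    rewrite /f /e mulrBr mulrDr -!scalerAr !scalerBr addrAC opprD.
    by rewrite [X in _ = X - _]addrACA.
  rewrite /e -scaleNr -[in X in creates _ X]scaleNr.
  apply: creates_add; last by apply: createsZ; exact: creates_mulb cf0.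
  by apply: creates_add; apply: createsZ; exact: creates_step.
have cg : creates h g.
  have -> : g = s *: (a * (b * f0)) + i *: (a * (b * g0)) - i *: (a * f0 - e0).
    rewrite /g /h mulrBr mulrDr -!scalerAr [in RHS]scalerBr opprB addrA.
    by rewrite addrAC.
  rewrite /h -scaleNr -[in X in creates _ X]scaleNr.
  apply: creates_add; last by apply: createsZ; exact: creates_step.
  apply: creates_add; apply: createsZ; first exact: creates_mulb cf0.
  exact: creates_mulb cg0.
have nf := null_creates cf0; have ng := null_creates cg0.
have be : null (b * e - h).
  have -> : b * e - h = - i *: (b * (b * f0) - f0).
    rewrite /e /h mulrBr mulrDr -!scalerAr opprB addrC subrKA.
    by rewrite scaleNr scalerBr opprB.
  exact: null_scale.
have bh : null (b * h - e).
  have -> : b * h - e = s *: (b * (b * f0) - f0) + i *: (b * (b * g0) - g0).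
    rewrite /e /h mulrBr mulrDr -!scalerAr opprB subrKA.
    by rewrite opprD addrACA -!scalerBr.
  by apply: null_add; exact: null_scale.
exists e, h, f, g; split=> //; split=> //.
rewrite chebSS.
set p1 := cheb v x n.+1; set p0 := cheb v x n.
(* [N] collects the errors made by replacing [b e] with [h], [b e0] with [h0] and [b h0] with [e0].
   Of the two copies of [e0] in [v], one comes from annihilating [h], the other from [b h0]. *)
pose N := i *: (a * (b * e - h)) - (i * s) *: (b * e0 - h0) + (b * h0 - e0).
have -> : s *: f + i *: g - i *: (b * f) = x * e - v *: e0 - N.
  rewrite Xmul /f /g /N /v; move: (e) (h) => e1 h1.
  rewrite !mulrBr !mulrDr -!scalerAr !scalerBr !scalerDr.
  rewrite !scalerDl scale1r !scalerA sqr_i scaleN1r scaleN1r -expr2 (mulrC s i).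
  exact: zmod_regroup.
have -> : x * p1 - v *: p0 - (x * e - v *: e0 - N) =
    x * (p1 - e) - v *: (p0 - e0) + N.
  move: (e) (N) => e1 N1; rewrite mulrBr scalerBr !opprB !addrA.
  by rewrite [LHS](ACl (1*5*4*2*3)%AC).
apply: null_add; first apply: null_sub.
- rewrite Xmul; apply: null_sub; [apply: null_add|]; apply: null_scale.
  + exact: null_mula.
  + by apply: null_mula; apply: null_mulb.
  + by apply: null_mulb; apply: null_mula.
- exact: null_scale.
- rewrite /N; apply: null_add => //; apply: null_sub; apply: null_scale => //.
  exact: null_mula.
Qed.

Lemma phi_cheb_fock n : phi (cheb v x n.+1) = 0.
Proof.
have [e0 [h0 [f0 [g0 [cf cg _ _ [_ /phi_null]]]]]] := cheb_fock n.
rewrite !linearB linearD !linearZ /= (phi_creates cf) (phi_creates cg).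
by rewrite (phi_mulb_creates cf) !mulr0 addr0 !subr0.
Qed.

End Recurrence.

(** Of the four words in the expansion, [aabaab] and [abaaba] contribute 1 each; the other two
    reduce to centred alternating words. *)
Lemma phi_acac (i : K) (c := i *: (a * b - b * a)) :
  i * i = -1 -> phi (a * c * a * c) = -2.
Proof.
move=> sqr_i; have -> : a * c * a * c =
    - (a * (a * (b * (a * (a * b)))) - a * (b * (a * (a * (a * b)))) -
      (a * (a * (b * (a * (b * a)))) - a * (b * (a * (a * (b * a)))))).
  rewrite /c -!(scalerAl, scalerAr) scalerA sqr_i scaleN1r.
  by rewrite !(mulrBr, mulrBl) !mulrA.
have c1 := creates1; have cb := creates_b.
have phi_aa : phi (a * a) = 1.
  have := phi_creates (creates_step c1).
  by rewrite linearB /= phi1 => /eqP; rewrite subr_eq0 => /eqP.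
(* The inner pair [a a] contracts, leaving [phi (a a b b)], and [b b] is 1 modulo [null]. *)
have t1 : phi (a * (a * (b * (a * (a * b))))) = 1.
  have cabb := creates_mulb (creates_step cb).
  have := phi_creates (creates_step cabb).
  rewrite linearB /= (phi_mulb_creates (creates_step cb)) subr0.
  rewrite !mulrBr linearB /= => /eqP; rewrite subr_eq0 => /eqP ->.
  have := phi_null (null_mula (null_mula null_sqr_b1)).
  by rewrite !mulrBr mulr1 linearB /= phi_aa => /eqP; rewrite subr_eq0 => /eqP.
have t2 : phi (a * (a * (b * (a * (b * a))))) = 0.
  have cba := creates_mulb c1.
  have := phi_creates (creates_step (creates_mulb cba)).
  by rewrite linearB /= (phi_mulb_creates cba) subr0.
have t3 : phi (a * (b * (a * (a * (a * b))))) = 0.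
  have := phi_creates (creates_mulb (creates_step (creates_step cb))).
  rewrite !mulrBr !linearB /= (phi_creates (creates_mulb cb)) !subr0.
  exact.
have t4 : phi (a * (b * (a * (a * (b * a))))) = 1.
  have := phi_creates (creates_mulb (creates_step (creates_mulb c1))).
  rewrite !mulrBr linearB /= => /eqP; rewrite subr_eq0 => /eqP ->.
  have := phi_null (null_mula (null_creates c1)).
  by rewrite mulrBr linearB /= phi_aa => /eqP; rewrite subr_eq0 => /eqP.
by rewrite linearN !linearB /= t1 t2 t3 t4; ring.
Qed.

End ReducedWords.

(** * Application to a semicircular element free from a Bernoulli one *)

Section FreePair.
Variables (R : realType) (M : ncProbSpace R) (a b : M).
Hypotheses (ha : semicircular 1 a) (hb : symmetric_bernoulli b).
Hypothesis hab : nc_free a b.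

Lemma state_word w : w != [::] -> reduced (state M) a b w ->
  state M (word_val a b w) = 0.
Proof.
move=> w0 rw; rewrite /word_val.
rewrite -(big_map (fun l => (l.1, letter_val a b l)) xpredT snd).
apply: hab.
- by case: w w0 {rw}.
- case: w {w0} rw => //= l w [_ + rw]; elim: w l rw => //= l' w IH l [_ sl' rw].
  by move=> /eqP ll'; apply/andP; split; [rewrite ll'; case: (l.1)|exact: IH].
- elim: w rw {w0} => //= l w IH [l0 _ rw] _ /[!inE] /predU1P[->|/(IH rw)//].
  by split=> //; apply/gen_subalgP; exists l.2; rewrite /letter_val.
Qed.

(** The moments of [b] have period two. The factor ['X^k] in the induction absorbs the X that Horner
    induction on [q] produces. *)
Lemma state_bernoulli_ideal (q : {poly R[i]}) :
  state M (horner_alg b (q * ('X^2 - 1))) = 0.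
Proof.
suff: forall k, state M (horner_alg b (q * ('X^k * ('X^2 - 1)))) = 0.
  by move=> /(_ 0); rewrite expr0 mul1r.
elim/poly_ind: q => [|q c IH] k; first by rewrite mul0r rmorph0 linear0.
rewrite mulrDl -mulrA [X in q * X]mulrA -exprS rmorphD linearD /= IH add0r.
rewrite rmorphM /= horner_algC mulr_algl linearZ /= mulrBr mulr1 -exprD.
rewrite rmorphB !rmorphXn /= horner_algX linearB /= !hb.2 -rmorphB /=.
have -> : (-1) ^+ (k + 2) = (-1) ^+ k :> R by rewrite exprD sqrrN expr1n mulr1.
by rewrite !expr1n subrr mulr0.
Qed.

Lemma state_cheb_a n : state M (cheb 1 a n.+1) = 0.
Proof. exact: (moments_cheb_state ltr01 ha.2). Qed.

Lemma state_bernoulli : state M b = 0.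
Proof. by have := hb.2 1; rewrite !expr1 addNr mul0r. Qed.

Let sqr_i : 'i * 'i = -1 :> R[i].
Proof. by rewrite -expr2 sqrCi. Qed.

Lemma semicircular_perturbation (s : R) :
  semicircular (s ^+ 2 + 2) (s%:C *: a + i_commutator a b).
Proof.
have v_gt0 : 0 < s ^+ 2 + 2 by rewrite ltr_wpDl ?sqr_ge0.
split.
  have conj_s : (s%:C : R[i])^*%R = s%:C by exact: conjc_real.
  rewrite /selfadjoint /i_commutator -[- (b * a)]scaleN1r.
  rewrite starD !starZ starD starZ.
  rewrite !starM ha.1 hb.1 conj_s conjCi rmorphN1 !scaleN1r.
  by rewrite scaleNr -scalerN opprB.
apply: cheb_state_moments => //.
  rewrite semicircle_moment0_scaling//.
  by have := ha.2 0; rewrite expr0 state1 => -[].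
move=> n; have -> : (s ^+ 2 + 2)%:C = s%:C ^+ 2 + 2.
  by rewrite rmorphD rmorphXn rmorph_nat.
exact: (phi_cheb_fock (@state1 R M) state_word state_bernoulli_ideal
  state_cheb_a state_bernoulli _ sqr_i).
Qed.

(** Freeness would make the state vanish on the alternating centred word [a c a c], where its value
    is -2. *)
Lemma commutator_not_free : ~ nc_free a (i_commutator a b).
Proof.
set c := i_commutator a b => free_ac.
(* This is the recurrence result at [s = 0] and [n = 0], since the first Chebyshev polynomial is the
   element itself. *)
have c0 : state M c = 0.
  have := phi_cheb_fock (@state1 R M) state_word state_bernoulli_ideal
    state_cheb_a state_bernoulli 0 sqr_i 0.
  by rewrite cheb1 scale0r add0r.
have a0 : state M a = 0 by have := state_cheb_a 0; rewrite cheb1.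
have := phi_acac (@state1 R M) state_word state_bernoulli_ideal state_cheb_a
  state_bernoulli sqr_i.
have := free_ac [:: (false, a); (true, c); (false, a); (true, c)] isT isT.
rewrite !big_cons big_nil mulr1 !mulrA => -> => [/eqP|p].
  by rewrite eq_sym oppr_eq0 pnatr_eq0.
have ga y : gen_subalg y y by apply/gen_subalgP; exists 'X; rewrite horner_algX.
by rewrite !inE => /or4P[] /eqP ->.
Qed.

End FreePair.

Theorem proposition7p2 (R : realType) (M : ncProbSpace R) (a b : M)
    (ha : semicircular 1 a) (hb : symmetric_bernoulli b) (hab : nc_free a b) :
  [/\ semicircular 1 a,
      semicircular 2 (i_commutator a b),
      ~ nc_free a (i_commutator a b)
    & forall sigma : R,
        semicircular (sigma ^+ 2 + 2) (sigma%:C *: a + i_commutator a b)].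
Proof.
split=> //.
- have := semicircular_perturbation ha hb hab 0.
  by rewrite expr0n add0r scale0r add0r.
- exact: commutator_not_free.
- exact: semicircular_perturbation.
Qed.
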